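(* Let $a$ be a complex number of modulus one and let $H$ be a $6\times 6$ complex Hadamard matrix all of whose entries lie in $\{1,a,\bar a\}$. Then $H$ is complex equivalent to the Tao matrix $S_6^{(0)}$ or to the matrix $H^{(1)}$, where, with $\omega=e^{2\pi i/3}$, $$S_6^{(0)}=\begin{bmatrix} 1&1&1&1&1&1\\ 1&1&\omega&\omega&\omega^2&\omega^2\\ 1&\omega&1&\omega^2&\omega^2&\omega\\ 1&\omega&\omega^2&1&\omega&\omega^2\\ 1&\omega^2&\omega^2&\omega&1&\omega\\ 1&\omega^2&\omega&\omega^2&\omega&1 \end{bmatrix},\qquad H^{(1)}=\begin{bmatrix} i&1&1&1&1&1\\ 1&i&1&1&-1&-1\\ 1&1&i&-1&1&-1\\ 1&1&-1&i&-1&1\\ 1&-1&1&-1&i&1\\ 1&-1&-1&1&1&i \end{bmatrix}.$$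
   Context: A complex Hadamard matrix (CHM) of order $n$ is an $n\times n$ complex matrix $H$ all of whose entries have modulus one and which satisfies $HH^\dagger=nI$. A monomial unitary matrix is a unitary matrix each of whose rows and columns has exactly one nonzero entry, that entry having modulus one. Two $n\times n$ matrices $U,V$ are complex equivalent if $U=PVQ$ for some $n\times n$ monomial unitary matrices $P,Q$. *)

(* Defs.v *)
(* Complex numbers: an arbitrary numClosedFieldType C
   (e.g. algC, or complex R for R real closed). *)
From HB Require Import structures.
From mathcomp Require Import all_boot all_order all_algebra.
Set Implicit Arguments. Unset Strict Implicit. Unset Printing Implicit Defensive.
Import Order.TTheory GRing.Theory Num.Theory.
Local Open Scope ring_scope.

Section Defs.
Variable C : numClosedFieldType.

Definition adjmx n m (A : 'M[C]_(n, m)) : 'M[C]_(m, n) := (map_mx Num.conj A)^T.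

Definition is_CHM n (H : 'M[C]_n) : Prop :=
  (forall i j, `|H i j| = 1) /\ H *m adjmx H = (n%:R)%:M.

Definition is_unitary n (U : 'M[C]_n) : Prop := U *m adjmx U = 1%:M.

Definition monomial_unitary n (P : 'M[C]_n) : Prop :=
  [/\ is_unitary P,
      (forall i, exists! j, P i j != 0),
      (forall j, exists! i, P i j != 0) &
      (forall i j, P i j != 0 -> `|P i j| = 1)].

Definition complex_equivalent n (U V : 'M[C]_n) : Prop :=
  exists P Q : 'M[C]_n, [/\ monomial_unitary P, monomial_unitary Q & U = P *m V *m Q].

(* omega = e^{2 pi i/3} = (-1 + i sqrt 3)/2 *)
Definition omega : C := (-1 + 'i * sqrtC 3) / 2.

Definition mx6_of (f : nat -> nat -> C) : 'M[C]_6 := \matrix_(i < 6, j < 6) f i j.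

Definition tao_exp : seq (seq nat) :=
  [:: [:: 0; 0; 0; 0; 0; 0]%N;
      [:: 0; 0; 1; 1; 2; 2]%N;
      [:: 0; 1; 0; 2; 2; 1]%N;
      [:: 0; 1; 2; 0; 1; 2]%N;
      [:: 0; 2; 2; 1; 0; 1]%N;
      [:: 0; 2; 1; 2; 1; 0]%N].

Definition S6_0 : 'M[C]_6 :=
  mx6_of (fun i j => omega ^+ nth 0%N (nth [::] tao_exp i) j).

Definition H1_sign : seq (seq C) :=
  [:: [:: 0; 1; 1; 1; 1; 1];
      [:: 1; 0; 1; 1; -1; -1];
      [:: 1; 1; 0; -1; 1; -1];
      [:: 1; 1; -1; 0; -1; 1];
      [:: 1; -1; 1; -1; 0; 1];
      [:: 1; -1; -1; 1; 1; 0]].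

Definition H1 : 'M[C]_6 :=
  mx6_of (fun i j => if i == j then 'i else nth 0 (nth [::] H1_sign i) j).

End Defs.

(* Main.v *)
(* An inner product of two rows of H is n0 + n1 a + m1 a^-1 + n2 a^2 + m2 a^-2
   with nonnegative integers n0, n1, m1, n2, m2 of sum 6, so x = a + a^-1 = 2 Re a
   is a root of a polynomial taken from a finite list.  If a^4 = 1 or a^3 = 1, then
   H is a Butson matrix over the 4th or 3rd roots of unity; after dephasing and
   sorting the second row there are few such matrices, and each of them is carried
   to H^(1) or to the Tao matrix by an explicit relabelling of columns.  Otherwise
   2x = 1, x = 1, x^2 + 2x = 2, 2x^2 + x = 4 or x^2 = 2, and in each of these
   cases the admissible vectors (n0, n1, m1, n2, m2) are so few that no five
   vectors with entries in {1, a, a^-1} are pairwise orthogonal. *)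
Require Import Defs.
From mathcomp Require Import all_boot all_order all_fingroup all_algebra.
From mathcomp Require Import ring zify.
Set Implicit Arguments. Unset Strict Implicit. Unset Printing Implicit Defensive.
Import Order.TTheory GRing.Theory Num.Theory.
Local Open Scope ring_scope.

(** * Clique searches over coded rows *)

Definition counts (d : nat) (s : seq nat) : seq nat :=
  [seq count_mem v s | v <- iota 0 d].

Definition diffs (delta : nat -> nat -> nat) (r s : seq nat) : seq nat :=
  [seq delta p.1 p.2 | p <- zip r s].

Definition orthb (d : nat) delta (ok : pred (seq nat)) : rel (seq nat) :=
  fun r s => ok (counts d (diffs delta r s)).

Fixpoint words (m k : nat) : seq (seq nat) :=
  if k is k'.+1 then [seq x :: w | x <- iota 0 m, w <- words m k'] else [:: [::]].

(** Filtering the candidates after each choice keeps only extensions of the current clique. With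
    [leaf := xpred0] and [k] positive, success means that no further [k] rows complete a clique. *)
Fixpoint all_cliques (orth : rel (seq nat)) (leaf : pred (seq (seq nat)))
    (k : nat) (acc cands : seq (seq nat)) : bool :=
  if k is k'.+1 then
    all (fun r => all_cliques orth leaf k' (r :: acc) (filter (orth r) cands)) cands
  else leaf acc.

Definition sub_mod (n p q : nat) : nat := ((p + (n - q)) %% n)%N.

(* The code k of an entry stands for the k-th element of (1, a, a^-1), and the
   code of a quotient of two entries for that of (1, a, a^-1, a^2, a^-2). *)
Definition sub_pm (p q : nat) : nat :=
  nth 0%N (nth [::] [:: [:: 0; 2; 1]; [:: 1; 0; 3]; [:: 2; 4; 0]]%N p) q.

(* Whether n0 + n1 a + m1 a^-1 + n2 a^2 + m2 a^-2 vanishes for a + a^-1 = p / q: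
   separate the parts antisymmetric and symmetric under a <-> a^-1 and clear
   denominators. *)
Definition rational_ok (p q : int) (c : seq nat) : bool :=
  let n k := Posz (nth 0%N c k) in
  (q * (n 1%N - n 2%N) + p * (n 3%N - n 4%N) == 0) &&
  (2 * n 0%N * q ^+ 2 + (n 1%N + n 2%N) * p * q
     + (n 3%N + n 4%N) * (p ^+ 2 - 2 * q ^+ 2) == 0).

(* For x = a + a^-1 these are the cases x = 1/2, x = 1, x^2 + 2x = 2,
   2x^2 + x = 4 and x^2 = 2. *)
Definition sporadic_oks : seq (pred (seq nat)) :=
  [:: rational_ok 1 2; rational_ok 1 1; eq_op [:: 0; 2; 2; 1; 1]%N;
      eq_op [:: 0; 1; 1; 2; 2]%N; eq_op [:: 0; 0; 0; 3; 3]%N].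

(** A column permutation preserves inner products, so the first of the five rows may be taken
    sorted. *)
Definition no_sporadic (ok : pred (seq nat)) : bool :=
  let orth := orthb 5 sub_pm ok in
  let W := words 3 6 in
  all (fun r => all_cliques orth xpred0 4 [:: r] (filter (orth r) W))
    (filter (sorted leq) W).

Lemma sporadic_none : all no_sporadic sporadic_oks.
Proof. by vm_compute. Qed.

Definition zero_row : seq nat := nseq 6 0%N.

(* Each e in rows is, modulo n, a row of T minus row 0 of T plus a constant, after
   relabelling the columns by g. *)
Definition equiv_rows (n : nat) (T : seq (seq nat)) (g : seq nat) (rows : seq (seq nat)) :=
  all (fun e => has (fun t => has (fun k =>
    all (fun j => nth 0 e j + nth 0 (nth [::] T 0) (nth 0 g j)
       == nth 0 (nth [::] T k) (nth 0 g j) + t %[mod n])%N (iota 0 6)) (iota 0 6)) (iota 0 n)) rows.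

(** In a dephased matrix row 0 is [zero_row] and the other rows begin with code 0 and are orthogonal
    to it. Row 1 is sorted by permuting columns, and the search chooses the remaining four. *)
Definition butson_check (n : nat) (ok : pred (seq nat)) T (gs : seq (seq nat)) : bool :=
  let orth := orthb n (sub_mod n) ok in
  let leaf rows := has (fun g => equiv_rows n T g (zero_row :: rows)) gs in
  let U := [seq r <- words n 6 | (nth 0%N r 0 == 0%N) && orth r zero_row] in
  all (fun r => all_cliques orth leaf 4 [:: r] (filter (orth r) U))
    (filter (sorted leq) U).

Definition balanced3 : pred (seq nat) := eq_op [:: 2; 2; 2]%N.
Definition balanced4 (c : seq nat) : bool :=
  (nth 0 c 0 == nth 0 c 2)%N && (nth 0 c 1 == nth 0 c 3)%N.

(* Witnesses found by computer search. *)
Definition tao_columns : seq (seq nat) := [:: [:: 0; 1; 2; 3; 4; 5]; [:: 0; 1; 2; 3; 5; 4]]%N.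
Definition H1_columns : seq (seq nat) :=
  [:: [:: 0; 1; 4; 2; 3; 5]; [:: 0; 1; 4; 2; 5; 3]; [:: 1; 2; 0; 3; 4; 5];
      [:: 1; 2; 0; 4; 3; 5]; [:: 1; 4; 2; 3; 5; 0]; [:: 1; 4; 2; 5; 3; 0];
      [:: 1; 4; 5; 0; 2; 3]; [:: 1; 4; 5; 0; 3; 2]]%N.
Definition H1_exp : seq (seq nat) :=
  [:: [:: 1; 0; 0; 0; 0; 0];
      [:: 0; 1; 0; 0; 2; 2];
      [:: 0; 0; 1; 2; 0; 2];
      [:: 0; 0; 2; 1; 2; 0];
      [:: 0; 2; 0; 2; 1; 0];
      [:: 0; 2; 2; 0; 0; 1]]%N.

Lemma butson3 : butson_check 3 balanced3 tao_exp tao_columns.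
Proof. by vm_compute. Qed.
Lemma butson4 : butson_check 4 balanced4 H1_exp H1_columns.
Proof. by vm_compute. Qed.

Definition count_vectors : seq (seq nat) := [seq c <- words 7 5 | sumn c == 6%N].

(** The antisymmetric part of a vanishing sum gives x = p / q with p = m1 - n1 and q = n2 - m2.
    Since |x| is at most 2, only 0, -1, 2, -2, 1 and 1/2 remain. *)
Lemma rational_analysis :
  all (fun c => let p := Posz (nth 0%N c 2) - Posz (nth 0%N c 1) in
    let q := Posz (nth 0%N c 3) - Posz (nth 0%N c 4) in
    [|| q == 0, ~~ rational_ok p q c, `|p| > 2 * `|q|, p == 0, p == - q, p == 2 * q,
        p == - (2 * q), p == q | 2 * p == q]) count_vectors.
Proof. by vm_compute. Qed.

(** * Equivalence of complex Hadamard matrices *)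

Section Hadamard.
Variable C : numClosedFieldType.

Lemma norm1_conjM (z : C) : `|z| = 1 -> z * Num.conj z = 1.
Proof. by move=> z1; rewrite -normCK z1 expr1n. Qed.

Lemma chm_rows n (H : 'M[C]_n) i k : is_CHM H ->
  \sum_j H i j * Num.conj (H k j) = n%:R *+ (i == k).
Proof.
move=> [_ /matrixP/(_ i k)]; rewrite !mxE => <-.
by apply: eq_bigr => j _; rewrite !mxE.
Qed.

(** A one-sided inverse of a square matrix is two-sided, so orthogonality passes from rows to
    columns. *)
Lemma chm_cols n (H : 'M[C]_n) j k : is_CHM H ->
  \sum_i Num.conj (H i j) * H i k = n%:R *+ (j == k).
Proof.
case: n H j k => [|n] H j k; first by case: j.
move=> [_ HH]; have n0 : (n.+1%:R : C) != 0 by rewrite pnatr_eq0.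
have /mulmx1C : H *m ((n.+1%:R)^-1 *: adjmx H) = 1%:M.
  by rewrite -scalemxAr HH scale_scalar_mx mulVf.
rewrite -scalemxAl => /(congr1 (GRing.scale (n.+1%:R : C))).
rewrite scalerA divff // scale1r => /matrixP/(_ j k).
by rewrite !mxE mulr_natr => <-; apply: eq_bigr => i _; rewrite !mxE.
Qed.

Lemma chm_phase n (H : 'M[C]_n) (t : 'S_n) (r c : 'I_n -> C) :
    (forall i, `|r i| = 1) -> (forall j, `|c j| = 1) -> is_CHM H ->
  is_CHM (\matrix_(i, j) (r i * H i (t j) * c j)).
Proof.
move=> r1 c1 chmH; have [H1 _] := chmH; split=> [i j|].
  by rewrite !mxE !normrM r1 c1 H1 !mulr1.
apply/matrixP=> i k; rewrite !mxE.
rewrite (eq_bigr (fun j => r i * Num.conj (r k) * (H i (t j) * Num.conj (H k (t j))))).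
  rewrite -mulr_sumr -(reindex_inj (@perm_inj _ t) (P := xpredT)
    (F := fun j => H i j * Num.conj (H k j))) chm_rows //.
  case: eqVneq => [->|_]; last by rewrite !mulr0n mulr0.
  by rewrite norm1_conjM // mul1r.
move=> j _; rewrite !mxE !rmorphM /=.
by rewrite mulrACA -[RHS]mulr1 -(norm1_conjM (c1 j)); congr (_ * _); ring.
Qed.

Definition phase_mx n (s : 'S_n) (r : 'I_n -> C) : 'M[C]_n :=
  \matrix_(i, j) (r i *+ (j == s i)).

Lemma phase_mx_neq0 n (s : 'S_n) (r : 'I_n -> C) i j :
  (forall k, `|r k| = 1) -> (phase_mx s r i j != 0) = (j == s i).
Proof.
move=> r1; rewrite mxE; case: (j == s i); last by rewrite mulr0n eqxx.
by rewrite -normr_eq0 r1 oner_eq0.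
Qed.

Lemma monomial_phase_mx n (s : 'S_n) (r : 'I_n -> C) :
  (forall k, `|r k| = 1) -> monomial_unitary (phase_mx s r).
Proof.
move=> r1; split=> [|i|j|i j]; last 1 first.
- by rewrite phase_mx_neq0 // mxE => /eqP->; rewrite eqxx r1.
- apply/matrixP=> i k; rewrite !mxE (bigD1 (s i)) //= big1 => [|j /negPf nj].
    rewrite !mxE eqxx addr0 (inj_eq perm_inj).
    by case: eqVneq => [->|_] /=; rewrite ?mulr1n ?norm1_conjM // rmorph0 mulr0.
  by rewrite !mxE nj mul0r.
- exists (s i); split=> [|j]; first by rewrite phase_mx_neq0.
  by rewrite phase_mx_neq0 // => /eqP.
- exists ((s^-1)%g j); split=> [|i]; first by rewrite phase_mx_neq0 // permKV.
  by rewrite phase_mx_neq0 // => /eqP->; rewrite permK.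
Qed.

(* No injectivity of [f] and [g] is assumed: a repeated index would make two
   rows or two columns of [H] proportional. *)
Lemma chm_equivalent n (H V : 'M[C]_n) (f g : 'I_n -> 'I_n) (r c : 'I_n -> C) :
    is_CHM H -> (forall i, `|r i| = 1) -> (forall j, `|c j| = 1) ->
    (forall i j, H i j = r i * V (f i) (g j) * c j) ->
  complex_equivalent H V.
Proof.
move=> chmH r1 c1 HV; have [H1 _] := chmH.
have n0 (i : 'I_n) : (n%:R : C) != 0.
  by rewrite pnatr_eq0 -lt0n (leq_trans _ (ltn_ord i)).
have V1 i j : `|V (f i) (g j)| = 1.
  by move: (H1 i j); rewrite HV !normrM r1 c1 mul1r mulr1.
have f_inj : injective f.
  move=> i k fik; apply/eqP; apply: contraTT (n0 i) => /negPf ik; apply/negPn.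
  have:= chm_rows i k chmH; rewrite ik mulr0n.
  rewrite (eq_bigr (fun=> r i * Num.conj (r k))) => [|j _].
    rewrite sumr_const card_ord pnatr_eq0 => /eqP.
    by rewrite mulrn_eq0 => /orP[//|]; rewrite -normr_eq0 normrM norm_conjC !r1 mulr1 oner_eq0.
  rewrite !HV fik !rmorphM /= -[RHS]mulr1 -(norm1_conjM (c1 j)).
  by rewrite -[RHS]mulr1 -(norm1_conjM (V1 k j)); ring.
have g_inj : injective g.
  move=> j k gjk; apply/eqP; apply: contraTT (n0 j) => /negPf jk; apply/negPn.
  have:= chm_cols j k chmH; rewrite jk mulr0n.
  rewrite (eq_bigr (fun=> Num.conj (c j) * c k)) => [|i _].
    rewrite sumr_const card_ord pnatr_eq0 => /eqP.
    by rewrite mulrn_eq0 => /orP[//|]; rewrite -normr_eq0 normrM norm_conjC !c1 mulr1 oner_eq0.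
  rewrite !HV gjk !rmorphM /= -[RHS]mulr1 -(norm1_conjM (r1 i)).
  by rewrite -[RHS]mulr1 -(norm1_conjM (V1 i k)); ring.
(* Right multiplication by [phase_mx t] moves columns by the inverse of [t], hence the inverse of
   [g] here and the phases reindexed by [t]. *)
pose s := perm f_inj; pose t := (perm g_inj)^-1%g.
exists (phase_mx s r), (phase_mx t (fun k => c (t k))).
split; try exact: monomial_phase_mx.
apply/matrixP=> i j; rewrite mxE (bigD1 (g j)) //= big1 => [|l lj].
  rewrite mxE (bigD1 (f i)) //= big1 => [|k ki].
    rewrite !mxE permE eqxx /t -(permE g_inj) permK eqxx permE !mulr1n !addr0.
    exact: HV.
  by rewrite mxE permE (negPf ki) mul0r.
rewrite [X in _ * X]mxE; case: eqP => [jl|_]; last by rewrite mulr0.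
by case/eqP: lj; rewrite jl -(permE g_inj) /t permKV.
Qed.

End Hadamard.

(** * Soundness of the searches *)

Lemma mem_words m k (w : seq nat) :
  size w = k -> all (gtn m) w -> w \in words m k.
Proof.
elim: k w => [|k IHk] [|x w] //= [sw] /andP[xm wm].
by apply: allpairs_f; [rewrite mem_iota | apply: IHk].
Qed.

(** Induction along [s]: its elements mark one branch of the search, and pairwise orthogonality
    keeps the later ones among the filtered candidates. *)
Lemma all_cliquesP orth leaf s acc cands :
    all_cliques orth leaf (size s) acc cands -> {subset s <= cands} ->
    pairwise orth s -> leaf (catrev s acc).
Proof.
elim: s acc cands => [|r s IHs] acc cands //= /allP H sub /andP[rs ps].
apply: IHs (H r (sub r (mem_head _ _))) _ ps => x xs.
by rewrite mem_filter (allP rs) // sub // inE xs orbT.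
Qed.

Definition code_row (e : 'I_6 -> nat) : seq nat := [seq e j | j <- enum 'I_6].

Lemma size_code_row e : size (code_row e) = 6%N.
Proof. by rewrite size_map size_enum_ord. Qed.

Lemma nth_code_row e (j : 'I_6) : nth 0%N (code_row e) j = e j.
Proof. by rewrite (nth_map j) ?size_enum_ord // nth_ord_enum. Qed.

Lemma code_row_words m e : (forall j, e j < m)%N -> code_row e \in words m 6.
Proof.
move=> em; apply: mem_words; first exact: size_code_row.
by apply/allP=> x /mapP[j _ ->]; exact: em.
Qed.

Lemma sort_code_row e :
  exists t : 'S_6, sorted leq (code_row (fun j => e (t j))).
Proof.
have : perm_eq (sort leq (code_row e)) [tuple e j | j < 6].
  by rewrite perm_sort perm_refl.
case/tuple_permP=> t tE; exists t.
have -> : code_row (fun j => e (t j)) = sort leq (code_row e).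
  by rewrite tE /code_row /=; apply: eq_map => j; rewrite tnth_mktuple.
by apply: sort_sorted => x y; exact: leq_total.
Qed.

(** Stated over any [nmodType] to serve both complex sums and, with [F] constantly 1, the length of
    the list. *)
Lemma sum_counts (V : nmodType) d (s : seq nat) (F : nat -> V) :
    all (gtn d) s ->
  \sum_(x <- s) F x = \sum_(v < d) F v *+ nth 0%N (counts d s) v.
Proof.
move=> sd.
have cE (v : 'I_d) : nth 0%N (counts d s) v = count_mem (v : nat) s.
  by rewrite (nth_map 0%N) ?size_iota // nth_iota // add0n.
under [RHS]eq_bigr do rewrite cE.
elim: s sd {cE} => [_|x s IHs /= /andP[xd sd]].
  by rewrite big_nil big1 // => v _; rewrite mulr0n.
rewrite big_cons IHs //.
under [RHS]eq_bigr do rewrite mulrnDr.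
rewrite big_split /=; congr (_ + _).
rewrite (bigD1 (Ordinal xd)) //= eqxx mulr1n big1 ?addr0 // => v.
by rewrite -val_eqE /= eq_sym => /negPf->; rewrite mulr0n.
Qed.

Lemma sumn_counts d (s : seq nat) : all (gtn d) s -> sumn (counts d s) = size s.
Proof.
move=> sd; have := sum_counts (fun=> 1%N) sd.
rewrite -(big_mkord xpredT (fun v => 1%N *+ nth 0%N (counts d s) v)) => sE.
rewrite -[RHS]sum1_size [RHS]sE sumnE (big_nth 0%N) size_map size_iota.
by apply: eq_bigr => v _; rewrite natn.
Qed.

Section Coding.
Variables (C : numClosedFieldType) (w F : nat -> C) (m d : nat).
Variables (delta : nat -> nat -> nat) (ok : pred (seq nat)).
Hypothesis deltaP : forall p q, (p < m)%N -> (q < m)%N ->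
  (delta p q < d)%N /\ w p * Num.conj (w q) = F (delta p q).
Hypothesis okP : forall c, size c = d -> sumn c = 6%N ->
  \sum_(v < d) F v *+ nth 0%N c v = 0 -> ok c.

(** Grouping the six quotients by code makes the inner product depend on the count vector alone, so
    [ok] need only be a necessary condition for vanishing. *)
Lemma orthb_code_row (e f : 'I_6 -> nat) :
    (forall j, e j < m)%N -> (forall j, f j < m)%N ->
    \sum_j w (e j) * Num.conj (w (f j)) = 0 ->
  orthb d delta ok (code_row e) (code_row f).
Proof.
move=> em fm ef0.
have dE : diffs delta (code_row e) (code_row f) = code_row (fun j => delta (e j) (f j)).
  by rewrite /diffs /code_row zip_map -map_comp.
have dd : all (gtn d) (code_row (fun j => delta (e j) (f j))).
  by apply/allP=> x /mapP[j _ ->]; case: (deltaP (em j) (fm j)).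
rewrite /orthb dE; apply: okP.
- by rewrite size_map size_iota.
- by rewrite sumn_counts // size_code_row.
- rewrite -(sum_counts F dd) big_map -[RHS]ef0 big_enum.
  by apply: eq_bigr => j _; case: (deltaP (em j) (fm j)).
Qed.

End Coding.

Local Notation "''o_' k" := (@Ordinal 6 k isT) (at level 8, k at level 2, format "''o_' k").

Lemma code_row_cliques m (orth : rel (seq nat)) leaf (f : pred (seq nat))
    (E : 'I_6 -> 'I_6 -> nat) (s : seq 'I_6) :
    (forall i j, E i j < m)%N ->
    (forall i k, i != k -> orth (code_row (E i)) (code_row (E k))) ->
    uniq s -> {in s, forall i, f (code_row (E i))} ->
    forall r, r \notin s ->
    all_cliques orth leaf (size s) [:: code_row (E r)]
      (filter (orth (code_row (E r))) (filter f (words m 6))) ->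
  leaf (catrev [seq code_row (E i) | i <- s] [:: code_row (E r)]).
Proof.
move=> Em Eorth us fs r rs; rewrite -(size_map (fun i => code_row (E i)) s).
move=> /all_cliquesP; apply.
  move=> _ /mapP[i is_ ->]; rewrite !mem_filter fs // code_row_words // !andbT.
  by apply: Eorth; apply: contraNneq rs => ->.
rewrite pairwise_map; move: us; rewrite uniq_pairwise.
by apply: sub_pairwise => i k /= ik; exact: Eorth.
Qed.

(** * Exclusion of the sporadic values of [a] *)

Section Sporadic.
Variables (C : numClosedFieldType) (a : C).
Hypothesis a1 : `|a| = 1.

Definition pm_pow (k : nat) : C := nth 0 [:: 1; a; Num.conj a] k.
Definition pm_pow2 (k : nat) : C :=
  nth 0 [:: 1; a; Num.conj a; a ^+ 2; Num.conj a ^+ 2] k.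

Lemma sub_pmP p q : (p < 3)%N -> (q < 3)%N ->
  (sub_pm p q < 5)%N /\ pm_pow p * Num.conj (pm_pow q) = pm_pow2 (sub_pm p q).
Proof.
have aa := norm1_conjM a1; have aa' : Num.conj a * a = 1 by rewrite mulrC.
by case: p q => [|[|[|p]]] [|[|[|q]]] //= _ _; split=> //;
  rewrite /pm_pow /pm_pow2 /= ?rmorph1 ?conjCK ?mul1r ?mulr1 ?expr2.
Qed.

Lemma no_sporadic_chm (ok : pred (seq nat)) (H : 'M[C]_6) :
    no_sporadic ok ->
    (forall c, size c = 5%N -> sumn c = 6%N ->
      \sum_(v < 5) pm_pow2 v *+ nth 0%N c v = 0 -> ok c) ->
    is_CHM H -> (forall i j, H i j = 1 \/ H i j = a \/ H i j = Num.conj a) -> False.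
Proof.
move=> none okP chmH Ha.
pose E0 i j := find (pred1 (H i j)) [:: 1; a; Num.conj a].
have E0P i j : (E0 i j < 3)%N /\ pm_pow (E0 i j) = H i j.
  have hH : has (pred1 (H i j)) [:: 1; a; Num.conj a].
    by case: (Ha i j) => [|[]] ->; rewrite /= eqxx ?orbT.
  by split; [rewrite -has_find | apply/eqP; exact: (nth_find 0 hH)].
have [t tE] := sort_code_row (E0 'o_0).
pose E i j := E0 i (t j).
have Elt i j : (E i j < 3)%N by case: (E0P i (t j)).
have Eorth i k : i != k ->
    orthb 5 sub_pm ok (code_row (E i)) (code_row (E k)).
  move=> /negPf ik; apply: (orthb_code_row sub_pmP okP) => //.
  have := chm_rows i k chmH; rewrite ik mulr0n (reindex_inj (@perm_inj _ t)).
  by move=> S0; rewrite -[RHS]S0; apply: eq_bigr => j _; rewrite !(proj2 (E0P _ _)).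
move/allP: none => /(_ (code_row (E 'o_0))).
rewrite mem_filter tE code_row_words // => /(_ isT) none.
(* The first five rows of [H] would form a clique that the search has excluded. *)
have := @code_row_cliques 3 _ xpred0 predT E [:: 'o_1; 'o_2; 'o_3; 'o_4] Elt Eorth isT _ 'o_0 isT.
by rewrite filter_predT => H0; have : false by exact: H0.
Qed.

End Sporadic.

(** * Butson matrices over the n-th roots of unity *)

Section Butson.
Variables (C : numClosedFieldType) (z : C) (n : nat).
Hypotheses (n_gt0 : (0 < n)%N) (zn : z ^+ n = 1).

Lemma norm_root1 : `|z| = 1.
Proof.
apply/eqP; rewrite -(@pexpr_eq1 _ _ n) ?normr_ge0 //.
by rewrite -normrX zn normr1.
Qed.

Definition zpow (y : C) : Prop := exists k, y = z ^+ k.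

Lemma zpowM x y : zpow x -> zpow y -> zpow (x * y).
Proof. by move=> [k ->] [l ->]; exists (k + l)%N; rewrite exprD. Qed.

Lemma conj_zX k : (k <= n)%N -> Num.conj (z ^+ k) = z ^+ (n - k).
Proof.
move=> kn; have zk1 : `|z ^+ k| = 1 by rewrite normrX norm_root1 expr1n.
rewrite -[LHS]mul1r -zn -{1}(subnK kn) exprD -mulrA.
by rewrite norm1_conjM // mulr1.
Qed.

Lemma zpow_conj y : zpow y -> zpow (Num.conj y).
Proof.
move=> [k ->]; exists (n - k %% n)%N.
by rewrite -conj_zX ?expr_mod // ltnW // ltn_mod.
Qed.

Lemma zpow_norm y : zpow y -> `|y| = 1.
Proof. by move=> [k ->]; rewrite normrX norm_root1 expr1n. Qed.

(** The least exponent is taken, so that 1 has code 0 and comes first in sorted rows. *)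
Definition zlog (y : C) : nat := find (fun k => y == z ^+ k) (iota 0 n).

Lemma zlogP y : zpow y -> (zlog y < n)%N /\ z ^+ zlog y = y.
Proof.
move=> [k yk].
have hy : has (fun k => y == z ^+ k) (iota 0 n).
  apply/hasP; exists (k %% n)%N; first by rewrite mem_iota ltn_mod.
  by rewrite yk expr_mod.
have lt : (zlog y < n)%N by rewrite /zlog -[X in (_ < X)%N](size_iota 0 n) -has_find.
split=> //; have /eqP := nth_find 0%N hy.
by rewrite nth_iota.
Qed.

Lemma zlog1 : zlog 1 = 0%N.
Proof. by rewrite /zlog; case: (n) n_gt0 => //= k _; rewrite expr0 eqxx. Qed.

Lemma sub_modP p q : (p < n)%N -> (q < n)%N ->
  (sub_mod n p q < n)%N /\ z ^+ p * Num.conj (z ^+ q) = z ^+ sub_mod n p q.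
Proof.
move=> pn qn; rewrite ltn_mod; split=> //.
by rewrite conj_zX 1?ltnW // expr_mod // exprD.
Qed.

Lemma butson_equivalent (ok : pred (seq nat)) T gs (H : 'M[C]_6) :
    butson_check n ok T gs ->
    (forall g, g \in gs -> all (gtn 6) g) ->
    (forall c, size c = n -> sumn c = 6%N ->
      \sum_(v < n) z ^+ v *+ nth 0%N c v = 0 -> ok c) ->
    is_CHM H -> (forall i j, zpow (H i j)) ->
  complex_equivalent H (mx6_of (fun i j => z ^+ nth 0%N (nth [::] T i) j)).
Proof.
move=> check gs6 okP chmH Hz; set V := mx6_of _.
(* Dephased second row.  Sorting it puts a 1 in front, so the final dephasing of
   the first column leaves it sorted. *)
pose u j := H 'o_1 j * Num.conj (H 'o_0 j) * (Num.conj (H 'o_1 'o_0) * H 'o_0 'o_0).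
have uz j : zpow (u j) by do ![apply: zpowM | apply: zpow_conj | exact: Hz].
have [t tE] := sort_code_row (fun j => zlog (u j)).
have HH i j := norm1_conjM (zpow_norm (Hz i j)).
(* Code 0 occurs in [u], at column 0 of [H], so the sorted row begins with it. *)
have u0 : u (t 'o_0) = 1.
  rewrite -(proj2 (zlogP (uz _))); suff -> : zlog (u (t 'o_0)) = 0%N by [].
  have u1 : zlog (u 'o_0) = 0%N.
    rewrite -[RHS]zlog1; congr zlog; rewrite /u.
    by rewrite -[RHS](HH 'o_1 'o_0) -[RHS]mulr1 -[X in _ = _ * X](HH 'o_0 'o_0); ring.
  have := sorted_leq_nth leq_trans leqnn 0%N tE.
  move=> /(_ (nat_of_ord 'o_0) (nat_of_ord ((t^-1)%g 'o_0))).
  rewrite !inE size_code_row !nth_code_row permKV u1 leqn0.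
  by move=> le0; apply/eqP/le0.
pose c j := Num.conj (H 'o_0 (t j)).
pose r i := Num.conj (H i (t 'o_0)) * H 'o_0 (t 'o_0).
have rz i : zpow (r i) by do ![apply: zpowM | apply: zpow_conj | exact: Hz].
have cz j : zpow (c j) by do ![apply: zpowM | apply: zpow_conj | exact: Hz].
pose K : 'M[C]_6 := \matrix_(i, j) (r i * H i (t j) * c j).
have KE i j : K i j = r i * H i (t j) * c j by rewrite mxE.
have chmK : is_CHM K by apply: chm_phase => // k; exact: zpow_norm.
have Kz i j : zpow (K i j) by rewrite KE; apply: zpowM => //; apply: zpowM.
have K0 j : K 'o_0 j = 1.
  rewrite KE /r /c -[RHS](HH 'o_0 (t j)) -[RHS]mulr1 -[X in _ = _ * X](HH 'o_0 (t 'o_0)).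
  by ring.
have K00 i : K i 'o_0 = 1.
  rewrite KE /r /c -[RHS](HH i (t 'o_0)) -[RHS]mulr1 -[X in _ = _ * X](HH 'o_0 (t 'o_0)).
  by ring.
have K1 j : K 'o_1 j = u (t j).
  rewrite KE /r /c -[LHS]mulr1 -u0 /u.
  rewrite -[RHS]mulr1 -[X in _ = _ * X](HH 'o_1 (t 'o_0)).
  rewrite -[RHS]mulr1 -[X in _ = _ * X](HH 'o_0 (t 'o_0)).
  by ring.
pose E i j := zlog (K i j).
have EK i j : (E i j < n)%N /\ z ^+ E i j = K i j by exact: zlogP.
have Elt i j : (E i j < n)%N by case: (EK i j).
have Eorth i k : i != k ->
    orthb n (sub_mod n) ok (code_row (E i)) (code_row (E k)).
  move=> /negPf ik; apply: (orthb_code_row sub_modP okP) => //.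
  have := chm_rows i k chmK; rewrite ik mulr0n => S0.
  by rewrite -[RHS]S0; apply: eq_bigr => j _; rewrite !(proj2 (EK _ _)).
have E0 : code_row (E 'o_0) = zero_row.
  apply: (@eq_from_nth _ 0%N) => [|j]; rewrite size_code_row // => j6.
  by rewrite (nth_code_row _ (Ordinal j6)) /E K0 zlog1 nth_nseq; case: ifP.
have EU i : i != 'o_0 ->
    (nth 0%N (code_row (E i)) 0 == 0%N) && orthb n (sub_mod n) ok (code_row (E i)) zero_row.
  move=> i0; rewrite -E0 Eorth // andbT.
  by rewrite (nth_code_row _ 'o_0) /E K00 zlog1.
have E1 : sorted leq (code_row (E 'o_1)).
  by congr (sorted _ _): tE; apply: eq_map => j; rewrite /E K1.
move/allP: check => /(_ (code_row (E 'o_1))).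
rewrite mem_filter E1 mem_filter (EU 'o_1) // code_row_words // => /(_ isT).
move=> /(@code_row_cliques n _ _ _ E [:: 'o_2; 'o_3; 'o_4; 'o_5] Elt Eorth isT _ 'o_1 isT).
case/(_ _)/hasP => [i|g ggs]; first by rewrite !inE => /or4P[] /eqP->; exact: EU.
(* Past the end of [g] the default 0 is still a valid column index. *)
have g6 (j : 'I_6) : (nth 0%N g j < 6)%N.
  have [jg|gj] := ltnP j (size g); last by rewrite nth_default.
  exact: (all_nthP 0%N (gs6 g ggs)).
rewrite -E0 => /allP eqg.
(* Each row of the dephased [K] is a row of [V] divided by row 0 of [V], with columns relabelled by
   [g], times a power of [z]. *)
have kt i : exists kt : 'I_6 * nat, forall j,
    K i j = z ^+ kt.2 * V kt.1 (Ordinal (g6 j)) * Num.conj (V 'o_0 (Ordinal (g6 j))).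
  have /eqg /hasP[s _ /hasP[k]] : code_row (E i) \in
      code_row (E 'o_0) :: catrev [seq code_row (E i) | i <- [:: 'o_2; 'o_3; 'o_4; 'o_5]]
         [:: code_row (E 'o_1)].
    (* [catrev] puts the rows after row 0 in the order 5, 4, 3, 2, 1. *)
    apply: (@map_f _ _ (fun i => code_row (E i)) [:: 'o_0; 'o_5; 'o_4; 'o_3; 'o_2; 'o_1]).
    by rewrite !inE -!val_eqE; case: i => -[|[|[|[|[|[|]]]]]].
  rewrite mem_iota add0n leq0n => k6 /allP eqk; exists (Ordinal k6, s) => j /=.
  have := eqk j; rewrite mem_iota ltn_ord nth_code_row => /(_ isT)/eqP eqj.
  have : z ^+ E i j * V 'o_0 (Ordinal (g6 j)) = z ^+ s * V (Ordinal k6) (Ordinal (g6 j)).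
    by rewrite !mxE /= -!exprD -(expr_mod _ zn) eqj expr_mod // addnC.
  rewrite (proj2 (EK i j)) => <-.
  by rewrite -mulrA norm1_conjM ?mulr1 // mxE normrX norm_root1 expr1n.
have [f fP] := fin_all_exists kt.
(* The dephasing of [K] and the sorting [t] are undone, and row 0 of [V] is absorbed into the column
   phases. *)
apply: (@chm_equivalent _ _ H V (fun i => (f i).1) (fun j => Ordinal (g6 ((t^-1)%g j)))
   (fun i => Num.conj (r i) * z ^+ (f i).2)
   (fun j => Num.conj (c ((t^-1)%g j)) * Num.conj (V 'o_0 (Ordinal (g6 ((t^-1)%g j)))))) => // [i|j|i j].
- by rewrite normrM normrX norm_root1 expr1n norm_conjC zpow_norm // mulr1.
- by rewrite normrM !norm_conjC zpow_norm // mul1r mxE normrX norm_root1 expr1n.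
- have -> : H i j = Num.conj (r i) * K i ((t^-1)%g j) * Num.conj (c ((t^-1)%g j)).
    rewrite KE permKV -[LHS]mulr1 -(norm1_conjM (zpow_norm (rz i))).
    by rewrite -[LHS]mulr1 -(norm1_conjM (zpow_norm (cz ((t^-1)%g j)))); ring.
  by rewrite fP; ring.
Qed.

End Butson.

(** * Vanishing sums of six quotients of entries *)

Lemma balanced_counts n0 n1 m1 n2 m2 :
    (n0 + (n1 + (m1 + (n2 + (m2 + 0)))) = 6)%N ->
    Posz m1 - Posz n1 = 0 -> Posz n2 - Posz m2 = 0 ->
  [/\ m1 = n1, m2 = n2, (n1 + n2 <= 3)%N & n0 = ((3 - (n1 + n2)) * 2)%N].
Proof. by move=> *; split; lia. Qed.

Section SporadicValues.
Variables (C : numClosedFieldType) (a : C).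
Hypothesis a1 : `|a| = 1.
Local Notation x := (a + Num.conj a).

(** The conjugate sum vanishes as well. The difference of the two is divisible by [a - Num.conj a];
    their total is a polynomial in [x], as a^2 + a^-2 = x^2 - 2. *)
Lemma vanishing_pm_sum c : size c = 5%N -> a != Num.conj a ->
    \sum_(v < 5) pm_pow2 a v *+ nth 0%N c v = 0 ->
  let n k : C := (nth 0%N c k)%:R in
  (n 1%N - n 2%N) + (n 3%N - n 4%N) * x = 0 /\
  2 * n 0%N + (n 1%N + n 2%N) * x + (n 3%N + n 4%N) * (x ^+ 2 - 2) = 0.
Proof.
case: c => [|n0 [|n1 [|m1 [|n2 [|m2 [|]]]]]] //= _ neq.
rewrite !big_ord_recl big_ord0 /pm_pow2 /= addr0.
rewrite -(mulr_natr 1) -(mulr_natr a) -(mulr_natr (Num.conj a)) -(mulr_natr (a ^+ 2)).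
rewrite -(mulr_natr (Num.conj a ^+ 2)).
have ab := norm1_conjM a1; move: (ab); set b := Num.conj a => ab' S.
have S' := congr1 Num.conj S; move: S'.
rewrite !(rmorphD, rmorphM, rmorphXn, rmorph1, rmorph_nat, rmorph0) /= -/b conjCK => S'.
have ab1 : a - b != 0 by rewrite subr_eq0.
split.
  apply: (mulfI ab1); rewrite mulr0.
  rewrite -[RHS](subrr 0) -{1}S -{1}S' mul1r; ring.
have -> : (a + b) ^+ 2 - 2 = a ^+ 2 + b ^+ 2.
  have -> : (2 : C) = 2 * (a * b) by rewrite ab mulr1.
  ring.
by rewrite -[RHS](addr0 0) -{1}S -{1}S' mul1r; ring.
Qed.

Lemma rational_okP (p q : int) c : size c = 5%N -> a != Num.conj a ->
    q != 0 -> q%:~R * x = p%:~R ->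
    \sum_(v < 5) pm_pow2 a v *+ nth 0%N c v = 0 ->
  rational_ok p q c.
Proof.
move=> sc neq q0 qx /(vanishing_pm_sum sc neq) /= [E1 E2].
apply/andP; split; rewrite -(intr_eq0 C) !(rmorphD, rmorphB, rmorphM, rmorphN, rmorphXn) /=
  -qx -!pmulrn; apply/eqP.
  rewrite -[RHS](mulr0 q%:~R) -E1; ring.
rewrite -[RHS](mulr0 (q%:~R ^+ 2)) -E2; ring.
Qed.

Lemma count_vector_mem c : size c = 5%N -> sumn c = 6%N -> c \in count_vectors.
Proof.
move=> sc c6; rewrite mem_filter c6 eqxx mem_words //.
apply/allP=> v vc; rewrite /= ltnS -c6 sumnE (big_rem v vc) /=; exact: leq_addr.
Qed.

(** The test depends on [x] alone, so one test serves all pairs of rows. The hypotheses on [a]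
    exclude x = 0, 2, -2 (fourth roots of unity) and x = -1 (cube roots). *)
Lemma sporadic_ok_exists : a ^+ 4 != 1 -> a ^+ 3 != 1 ->
  exists2 i, (i < size sporadic_oks)%N &
    forall c, size c = 5%N -> sumn c = 6%N ->
      \sum_(v < 5) pm_pow2 a v *+ nth 0%N c v = 0 -> nth xpred0 sporadic_oks i c.
Proof.
move=> a4 a3; have ab := norm1_conjM a1.
have neq : a != Num.conj a.
  apply: contraNneq a4 => aa; have a2 : a ^+ 2 = 1 by rewrite expr2 {2}aa.
  by rewrite (exprM a 2 2) a2 expr1n.
have ax : a * x = a ^+ 2 + 1 by rewrite mulrDr ab.
have x0 : x != 0.
  apply: contraNneq a4 => xE; move: ax; rewrite xE mulr0 => /esym/eqP.
  by rewrite addr_eq0 (exprM a 2 2) => /eqP->; rewrite sqrrN expr1n.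
have xN1 : x != -1.
  apply: contraNneq a3 => xE; rewrite -subr_eq0.
  have -> : a ^+ 3 - 1 = (a - 1) * (a ^+ 2 + 1 + a) by ring.
  by rewrite -ax xE mulrN1 addNr mulr0.
have x2 : x ^+ 2 != 4.
  apply: contraNneq a4 => xE; rewrite (exprM a 2 2).
  have : (a ^+ 2 - 1) ^+ 2 = 0.
    have -> : (a ^+ 2 - 1) ^+ 2 = (a ^+ 2 + 1) ^+ 2 - 4 * a ^+ 2 by ring.
    by rewrite -ax exprMn xE; ring.
  by move/eqP; rewrite expf_eq0 /= subr_eq0 => /eqP->; rewrite expr1n.
have xle : `|x| <= 2.
  by rewrite (le_trans (ler_normD _ _)) // norm_conjC a1.
have xreal : 0 <= x ^+ 2.
  by rewrite real_exprn_even_ge0 // CrealE rmorphD /= conjCK addrC.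
have two0 : (2 : C) != 0 by rewrite pnatr_eq0.
have [xh|xh] := eqVneq (2 * x) 1.
  by exists 0%N => // c sc c6; apply: (rational_okP sc neq (p := 1) (q := 2)).
have [x1|x1] := eqVneq x 1.
  by exists 1%N => // c sc c6; apply: (rational_okP sc neq) => //; rewrite mul1r.
(* Once 1/2 and 1 are set aside, [x] is none of the rational values of [rational_analysis]. Hence p
   = q = 0, and the counts of [a] and its conjugate agree, as do those of their squares. *)
have irr c : size c = 5%N -> sumn c = 6%N ->
    \sum_(v < 5) pm_pow2 a v *+ nth 0%N c v = 0 ->
    [\/ c = [:: 0; 2; 2; 1; 1]%N /\ x ^+ 2 + 2 * x = 2,
        c = [:: 0; 1; 1; 2; 2]%N /\ 2 * x ^+ 2 + x = 4 |
        c = [:: 0; 0; 0; 3; 3]%N /\ x ^+ 2 = 2].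
  move=> sc c6 S; have [E1 E2] := vanishing_pm_sum sc neq S.
  have /allP/(_ c (count_vector_mem sc c6)) := rational_analysis.
  set p := Posz _ - _; set q := Posz _ - _ => /=.
  have qx : q%:~R * x = p%:~R.
    apply/eqP; rewrite -subr_eq0 -E1 /p /q !rmorphB /= -!pmulrn; apply/eqP; ring.
  have [q0 _|q0 /=] := eqVneq q 0; last first.
    rewrite (rational_okP sc neq q0 qx S) /=.
    have -> /= : (2 * `|q| < `|p|) = false.
      apply/negbTE; rewrite -leNgt -(ler_int C) rmorphM /= !intr_norm -qx normrM mulrC.
      by rewrite ler_wpM2r.
    have qC : (q%:~R : C) != 0 by rewrite intr_eq0.
    have xE (k l : int) : k * p = l * q -> k%:~R * x = l%:~R.
      move=> /(congr1 (intmul (1 : C))); rewrite !rmorphM /= -qx mulrCA => kl.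
      by apply: (mulIf qC); rewrite -kl mulrC mulrCA.
    case/orP=> [/eqP pE|].
      have : 1%:~R * x = 0%:~R by apply: xE; rewrite pE; ring.
      by rewrite mul1r => /eqP; rewrite (negPf x0).
    case/orP=> [/eqP pE|].
      have : 1%:~R * x = (-1)%:~R by apply: xE; rewrite pE; ring.
      by rewrite mul1r => /eqP; rewrite (negPf xN1).
    case/orP=> [/eqP pE|].
      have : 1%:~R * x = 2%:~R by apply: xE; rewrite pE; ring.
      by rewrite mul1r => xx; move: x2; rewrite xx -natrX eqxx.
    case/orP=> [/eqP pE|].
      have : 1%:~R * x = (-2)%:~R by apply: xE; rewrite pE; ring.
      by rewrite mul1r => xx; move: x2; rewrite xx sqrrN -natrX eqxx.
    case/orP=> [/eqP pE|/eqP pE].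
      have : 1%:~R * x = 1%:~R by apply: xE; rewrite pE; ring.
      by rewrite mul1r => /eqP; rewrite (negPf x1).
    have : 2%:~R * x = 1%:~R by apply: xE; rewrite mul1r.
    by move=> /eqP; rewrite (negPf xh).
  have p0 : p = 0.
    by apply/eqP; rewrite -(intr_eq0 C) -qx q0 mul0r.
  move: sc c6 p0 q0 E2 {E1 S qx}; rewrite /p /q {p q}.
  case: c => [|n0 [|n1 [|m1 [|n2 [|m2 [|]]]]]] //= _ c6 p0 q0.
  have [-> -> n12 ->] := balanced_counts c6 p0 q0.
  rewrite natrM natrB // natrD => E.
  have {}E : 6 - 2 * n1%:R - 2 * n2%:R + n1%:R * x + n2%:R * (x ^+ 2 - 2) = 0 :> C.
    apply: (mulfI two0); rewrite mulr0 -[RHS]E; ring.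
  move: (x) n12 E xle xreal x0 xN1 x1 {c6 p0 q0} => y.
  (* Ten pairs with n1 + n2 at most 3 remain. The bound on |x|, the reality of [x] and the excluded
     values leave (n1, n2) = (2, 1), (1, 2) and (0, 3). *)
  case: n2 n1 => [|[|[|[|n2]]]] [|[|[|[|n1]]]] //= _ E yle y2 y0 yN1 y1.
  - by move/eqP: E; rewrite !(mulr0, mul0r, subr0, addr0) pnatr_eq0.
  - have yE : y = - 4 by apply/eqP; rewrite -subr_eq0 -E; apply/eqP; ring.
    by move: yle; rewrite yE normrN normr_nat ler_nat.
  - have /eqP : 2 * (y - -1) = 0 by rewrite -E; ring.
    by rewrite mulf_eq0 (negPf two0) subr_eq0 (negPf yN1).
  - have /eqP : 3 * y = 0 by rewrite -E; ring.
    by rewrite mulf_eq0 pnatr_eq0 (negPf y0).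
  - have yE : y ^+ 2 = - 2 by apply/eqP; rewrite -subr_eq0 -E; apply/eqP; ring.
    by move: y2; rewrite yE oppr_ge0 lern0.
  - have /eqP : y * (y - -1) = 0 by rewrite -E; ring.
    by rewrite mulf_eq0 (negPf y0) subr_eq0 (negPf yN1).
  - by constructor 1; split=> //; apply/eqP; rewrite -subr_eq0 -E; apply/eqP; ring.
  - have /eqP : 2 * ((y - 1) * (y - -1)) = 0 by rewrite -E; ring.
    by rewrite !mulf_eq0 (negPf two0) !subr_eq0 (negPf yN1) (negPf y1).
  - by constructor 2; split=> //; apply/eqP; rewrite -subr_eq0 -E; apply/eqP; ring.
  - constructor 3; split=> //.
    by apply/eqP; rewrite -subr_eq0 -(mulrI_eq0 _ (lregP (_ : 3 != 0 :> C))) ?pnatr_eq0 // -E; apply/eqP; ring.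
(* Any two of the three quadratic equations together force x = 0, so the one that holds determines
   the count vector. *)
have [e1|ne1] := eqVneq (x ^+ 2 + 2 * x) 2.
  exists 2%N => // c sc c6 S; case: (irr c sc c6 S) => -[-> E] //=.
    case/negP: x0; rewrite -(mulrI_eq0 _ (lregP (_ : 3 != 0 :> C))) ?pnatr_eq0 //.
    have -> : 3 * x = 2 * (x ^+ 2 + 2 * x) - (2 * x ^+ 2 + x) by ring.
    by rewrite e1 E; apply/eqP; ring.
  case/negP: x0; rewrite -(mulrI_eq0 _ (lregP two0)).
  by rewrite -(addKr (x ^+ 2) (2 * x)) e1 E addNr.
have [e2|ne2] := eqVneq (2 * x ^+ 2 + x) 4.
  exists 3%N => // c sc c6 S; case: (irr c sc c6 S) => -[-> E] //=.
    by rewrite E eqxx in ne1.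
  case/negP: x0; rewrite -(addKr (2 * x ^+ 2) x) e2 E.
  by apply/eqP; ring.
exists 4%N => // c sc c6 S; case: (irr c sc c6 S) => -[-> E] //=.
  by rewrite E eqxx in ne1.
by rewrite E eqxx in ne2.
Qed.
End SporadicValues.

Lemma no_sporadic_entry (C : numClosedFieldType) (a : C) (H : 'M[C]_6) :
    `|a| = 1 -> a ^+ 4 != 1 -> a ^+ 3 != 1 -> is_CHM H ->
    (forall i j, H i j = 1 \/ H i j = a \/ H i j = Num.conj a) -> False.
Proof.
move=> a1 a4 a3 chmH Ha; have [i i5 okP] := sporadic_ok_exists a1 a4 a3.
exact: (no_sporadic_chm a1 (elimT (all_nthP xpred0) sporadic_none i i5) okP chmH Ha).
Qed.

(** * Vanishing sums of cube and fourth roots of unity, and the conclusion *)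

(** Multiplying by p + q w gives the binary form p^2 + s p q + q^2, which is positive definite
    because s^2 < 4. The values s = -1 and s = 0 serve the cube and fourth roots. *)
Lemma int_binary_form (C : numClosedFieldType) (z w : C) (s p q : int) :
    s ^+ 2 < 4 -> z + w = s%:~R -> z * w = 1 -> p%:~R + q%:~R * z = 0 ->
  p = 0 /\ q = 0.
Proof.
move=> s4 zw1 zw2 pq.
have : (p%:~R + q%:~R * z) * (p%:~R + q%:~R * w) = 0 by rewrite pq mul0r.
have -> : (p%:~R + q%:~R * z) * (p%:~R + q%:~R * w) =
    p%:~R ^+ 2 + p%:~R * q%:~R * (z + w) + q%:~R ^+ 2 * (z * w) by ring.
rewrite zw1 zw2 mulr1 -!(rmorphXn, rmorphM, rmorphD) /= => /eqP.
rewrite intr_eq0 => /eqP E.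
have E4 : (2 * p + q * s) ^+ 2 + (4 - s ^+ 2) * q ^+ 2 = 0.
  by rewrite -[RHS](mulr0 4) -E; ring.
have q0 : q = 0.
  apply/eqP; apply: contraTT isT => qn0.
  have : 0 < (4 - s ^+ 2) * q ^+ 2 by rewrite mulr_gt0 ?subr_gt0 // exprn_even_gt0.
  by move/(ltr_wpDl (sqr_ge0 (2 * p + q * s))); rewrite E4.
split=> //; apply/eqP; move/eqP: E.
by rewrite q0 mulr0 mul0r expr0n !addr0 sqrf_eq0.
Qed.

Lemma omega_sum (C : numClosedFieldType) : omega C ^+ 2 + omega C + 1 = 0.
Proof.
have two0 : (2 : C) != 0 by rewrite pnatr_eq0.
have ss := sqrtCK (3 : C); have ii := sqrCi C.
apply: (mulfI two0); apply: (mulfI two0); rewrite /omega mulr0 mulr0.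
have -> : 2 * (2 * (((-1 + 'i * sqrtC 3) / 2) ^+ 2 + (-1 + 'i * sqrtC 3) / 2 + 1))
   = 3 + 'i ^+ 2 * sqrtC 3 ^+ 2 :> C by field.
by rewrite ss ii mulN1r subrr.
Qed.

Lemma balanced3_root (C : numClosedFieldType) c : size c = 3%N -> sumn c = 6%N ->
  \sum_(v < 3) omega C ^+ v *+ nth 0%N c v = 0 -> balanced3 c.
Proof.
have w2 : omega C ^+ 2 = - 1 - omega C.
  by apply/eqP; rewrite -subr_eq0 -(omega_sum C); apply/eqP; ring.
case: c => [|c0 [|c1 [|c2 [|]]]] //= _ c6.
rewrite !big_ord_recl big_ord0 /= addr0 expr0 expr1 w2.
rewrite -(mulr_natr 1) -(mulr_natr (omega C)) -(mulr_natr (-1 - omega C)) => S.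
(* Eliminating omega^2 leaves (c0 - c2) + (c1 - c2) omega = 0, so the three counts are equal. *)
have [] := @int_binary_form C (omega C) (omega C ^+ 2) (-1) (Posz c0 - Posz c2) (Posz c1 - Posz c2).
- by [].
- by rewrite w2; ring.
- have -> : omega C * omega C ^+ 2 = omega C * (omega C ^+ 2 + omega C + 1)
    - (omega C ^+ 2 + omega C + 1) + 1 by ring.
  by rewrite omega_sum; ring.
- by rewrite !rmorphB /= -!pmulrn -[RHS]S; ring.
move=> c02 c12; have -> : c0 = 2%N by clear -c02 c12 c6; lia.
have -> : c1 = 2%N by clear -c02 c12 c6; lia.
by have -> : c2 = 2%N by clear -c02 c12 c6; lia.
Qed.

Lemma balanced4_root (C : numClosedFieldType) c : size c = 4%N -> sumn c = 6%N ->
  \sum_(v < 4) ('i : C) ^+ v *+ nth 0%N c v = 0 -> balanced4 c.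
Proof.
have i2 := sqrCi C.
case: c => [|c0 [|c1 [|c2 [|c3 [|]]]]] //= _ _.
rewrite !big_ord_recl big_ord0 /= addr0 expr0 expr1.
rewrite (exprS _ 2) i2 -(mulr_natr 1) -(mulr_natr 'i) -(mulr_natr (-1)) -(mulr_natr ('i * -1)) => S.
have [] := @int_binary_form C 'i (- 'i) 0 (Posz c0 - Posz c2) (Posz c1 - Posz c3).
- by [].
- by rewrite subrr.
- by rewrite mulrN -expr2 i2 opprK.
- by rewrite !rmorphB /= -!pmulrn -[RHS]S; ring.
by move=> /eqP c02 /eqP c13; rewrite subr_eq0 in c02; rewrite subr_eq0 in c13; apply/andP.
Qed.

Lemma root4_zpow (C : numClosedFieldType) (y : C) : y ^+ 4 = 1 -> zpow 'i y.
Proof.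
move=> y4; have i2 := sqrCi C.
have : (y - 1) * (y + 1) * (y - 'i) * (y + 'i) = 0.
  have -> : (y - 1) * (y + 1) * (y - 'i) * (y + 'i) = (y ^+ 2 - 1) * (y ^+ 2 - 'i ^+ 2) by ring.
  by rewrite i2 opprK -subr_sqr_1 -exprM y4 subrr.
move/eqP; rewrite !mulf_eq0 !subr_eq0 !addr_eq0 => /orP[/orP[/orP[]|]|] /eqP->.
- by exists 0%N.
- by exists 2%N.
- by exists 1%N.
- by exists 3%N; rewrite exprS i2 mulrN1.
Qed.

Lemma root3_zpow (C : numClosedFieldType) (y : C) : y ^+ 3 = 1 -> zpow (omega C) y.
Proof.
move=> y3; have w := omega_sum C.
have : (y - 1) * ((y - omega C) * (y - omega C ^+ 2)) = 0.
  have -> : (y - 1) * ((y - omega C) * (y - omega C ^+ 2)) = y ^+ 3 - 1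
     + (omega C ^+ 2 + omega C + 1) * (y - 1) * (omega C - 1 - y) by ring.
  by rewrite w y3 subrr !mul0r addr0.
move/eqP; rewrite !mulf_eq0 !subr_eq0 => /or3P[] /eqP->.
- by exists 0%N.
- by exists 1%N.
- by exists 2%N.
Qed.

Lemma H1_expE (C : numClosedFieldType) :
  H1 C = mx6_of (fun i j => 'i ^+ nth 0%N (nth [::] H1_exp i) j).
Proof.
apply/matrixP=> -[[|[|[|[|[|[|i]]]]]] //= ?] [[|[|[|[|[|[|j]]]]]] //= ?];
  by rewrite !mxE /= ?expr0 ?expr1 ?sqrCi.
Qed.

Theorem mainTheorem8 (C : numClosedFieldType) (a : C) (H : 'M[C]_6) :
  `|a| = 1 ->
  is_CHM H ->
  (forall i j, H i j = 1 \/ H i j = a \/ H i j = Num.conj a) ->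
  complex_equivalent H (S6_0 C) \/ complex_equivalent H (H1 C).
Proof.
move=> a1 chmH Ha.
(* If [a] is an n-th root of unity, so is its conjugate, and [H] is a Butson matrix. *)
have Hn n i j : a ^+ n = 1 -> H i j ^+ n = 1.
  by move=> an; case: (Ha i j) => [|[]] ->; rewrite ?expr1n // -rmorphXn an rmorph1.
have [a4|a4] := eqVneq (a ^+ 4) 1.
  right; rewrite H1_expE.
  have i4 : 'i ^+ 4 = 1 :> C by rewrite (exprM _ 2 2) sqrCi sqrrN expr1n.
  apply: (butson_equivalent _ i4 butson4) => //; last first.
  - by move=> i j; apply: root4_zpow; exact: Hn.
  - exact: balanced4_root.
  - by apply/allP.
have [a3|a3] := eqVneq (a ^+ 3) 1; last first.
  by case: (no_sporadic_entry a1 a4 a3 chmH Ha).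
left.
have w3 : omega C ^+ 3 = 1.
  apply/eqP; rewrite -subr_eq0.
  have -> : omega C ^+ 3 - 1 = (omega C - 1) * (omega C ^+ 2 + omega C + 1) by ring.
  by rewrite omega_sum mulr0.
apply: (butson_equivalent _ w3 butson3) => //; last first.
- by move=> i j; apply: root3_zpow; exact: Hn.
- exact: balanced3_root.
- by apply/allP.
Qed.
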